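(* In $\mathbb{R}[x_1,x_2,x_3,x_4,x_5]$ let $$p_1=x_1^2-x_4^2,\quad p_2=x_2^2-x_4^2,\quad p_3=x_3^2-x_4^2,$$ $$p_4=-x_1^2-x_1x_2-x_1x_3+x_1x_4-x_2x_3+x_2x_4+x_3x_4,$$ $$p_5=x_1x_5+x_2x_5,\quad p_6=x_3x_5+x_2x_5,\quad p_7=x_5^2,$$ and let $g=p_1^2+p_2^2+p_3^2+p_4^2+p_5^2+p_6^2+p_7^2$. Then $g$ is a strictly positive polynomial in the boundary of $\Sigma_{5,4}$, and $g$ cannot be decomposed as the sum of 6 squares of real polynomials.
   Context: $H_{n,d}$ denotes the real vector space of homogeneous polynomials of degree $d$ in $n$ variables with coefficients in $\mathbb{R}$. $\Sigma_{5,4}\subset H_{5,4}$ is the convex cone of finite sums of squares of polynomials in $H_{5,2}$; its boundary is taken in $H_{5,4}$. A polynomial $g\in H_{5,4}$ is strictly positive if $g(x)>0$ for all $x\in\mathbb{R}^5\setminus\{0\}$. *)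

(* Defs.v *)
From HB Require Import structures.
From mathcomp Require Import all_boot all_order all_algebra.
From mathcomp Require Import mpoly.
From mathcomp Require Import boolp classical_sets reals topology normedtype.

Set Implicit Arguments.
Unset Strict Implicit.
Unset Printing Implicit Defensive.

Import Order.TTheory GRing.Theory Num.Theory.
Import numFieldNormedType.Exports.

Local Open Scope classical_set_scope.
Local Open Scope ring_scope.

(* V carries the topology transported from row vectors by the coordinate
   isomorphism [rVof] in a basis of V; it does not depend on that basis. *)
Definition vect_boundary (R : realType) (V : vectType R) (A : set V) : set V :=
  let coords : V -> 'rV[R]_(\dim {:V}) := passmx.rVof (vbasis {:V}) in
  coords @^-1` (closure (coords @` A) `\` interior (coords @` A)).

Definition Sigma54 (R : realType) : set (dhomog 5 R 4) :=
  [set f | exists s : seq (dhomog 5 R 2),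
     mpoly_of_dhomog f = \sum_(q <- s) mpoly_of_dhomog q ^+ 2].
Arguments Sigma54 : clear implicits.

Definition strictly_positive (R : realType) (n : nat) (p : {mpoly R[n]}) : Prop :=
  forall x : 'rV[R]_n, x != 0 -> 0 < p.@[x 0].

Section Example.
Variable R : realType.

(* 'I_5 is indexed from 0, so x_k is the variable of index k - 1. *)
Definition x1 : {mpoly R[5]} := 'X_(@Ordinal 5 0 isT).
Definition x2 : {mpoly R[5]} := 'X_(@Ordinal 5 1 isT).
Definition x3 : {mpoly R[5]} := 'X_(@Ordinal 5 2 isT).
Definition x4 : {mpoly R[5]} := 'X_(@Ordinal 5 3 isT).
Definition x5 : {mpoly R[5]} := 'X_(@Ordinal 5 4 isT).

Definition p1 : {mpoly R[5]} := x1 ^+ 2 - x4 ^+ 2.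
Definition p2 : {mpoly R[5]} := x2 ^+ 2 - x4 ^+ 2.
Definition p3 : {mpoly R[5]} := x3 ^+ 2 - x4 ^+ 2.
Definition p4 : {mpoly R[5]} :=
  - x1 ^+ 2 - x1 * x2 - x1 * x3 + x1 * x4 - x2 * x3 + x2 * x4 + x3 * x4.
Definition p5 : {mpoly R[5]} := x1 * x5 + x2 * x5.
Definition p6 : {mpoly R[5]} := x3 * x5 + x2 * x5.
Definition p7 : {mpoly R[5]} := x5 ^+ 2.

Definition g_poly : {mpoly R[5]} :=
  p1 ^+ 2 + p2 ^+ 2 + p3 ^+ 2 + p4 ^+ 2 + p5 ^+ 2 + p6 ^+ 2 + p7 ^+ 2.

Lemma g_poly_homog : g_poly \is 4.-homog.
Proof.
have hX (i j : 'I_5) : ('X_i * 'X_j : {mpoly R[5]}) \is 2.-homog.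
  by apply: (@dhomogM _ _ _ 1 _ 1); rewrite dhomogX; apply/eqP; exact: mdeg1.
have hs (p : {mpoly R[5]}) : p \is 2.-homog -> p ^+ 2 \is 4.-homog.
  by move=> hp; exact: (@dhomogMn _ _ _ 2 _ 2 hp).
rewrite /g_poly; do ![apply: rpredD]; apply: hs;
  rewrite /p1 /p2 /p3 /p4 /p5 /p6 /p7 ?expr2;
  do ![apply: rpredD | apply: rpredB | rewrite rpredN | exact: hX].
Qed.

Definition g : dhomog 5 R 4 := DHomog g_poly_homog.

End Example.

(* Main.v *)
Require Import Defs.
From mathcomp Require Import all_boot all_order all_algebra.
From mathcomp Require Import mpoly.
From mathcomp Require Import boolp classical_sets reals topology normedtype.
From mathcomp Require Import ring lra zify.

(** The proof reduces the cone of sums of squares to a face of a face.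

    Let [cube f] be the sum of the values of [f] at the seven vertices
    (+-1, +-1, +-1, 1, 0) of a cube other than v = (-1, -1, -1, 1, 0), minus
    f(v) / 7.  A quadratic form satisfies one linear relation with coefficients
    +-1 on the eight vertices (Cayley-Bacharach: the vertices are the complete
    intersection p1 = p2 = p3 = x5 = 0), so its value at v is a signed sum of
    the seven other values.  By Cauchy-Schwarz [cube (q ^+ 2)] is
    nonnegative, and it vanishes exactly when q is proportional to p4 on the
    cube; p4 takes there the values +-1 and, at v, -7, so [cube g] = 0.  As
    [cube] is nonnegative on the sums of squares and negative at -x1^4, the ray
    from g towards -x1^4 leaves the cone at once: g is on the boundary.  That p4
    vanishes at no vertex is also why g is strictly positive.

    Now let g be the sum of the squares of some q_i.  Restricting to lines
    through the origin shows that, as a function, q_i is its component of degree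
    two, a quadratic form.  Since [cube g] = 0, every [cube (q_i ^+ 2)] is 0,
    which puts the restriction of q_i to x5 = 0 in the span of p1, ..., p4.  On
    such forms a second functional becomes nonnegative on squares: [slope], the
    coefficient of x5^2 evaluated at (-1, 1, -1, 0) and at (0, 0, 0, 1), is then
    the sum of the squares of the x5-slopes of q_i at these two points.  Again
    [slope g] = 0, and the vanishing of both slopes leaves exactly the span of
    p1, ..., p7 ([slope_sqr_eq0]).

    Hence q_i = sum_j A_ij p_j for a real matrix A with seven columns, and
    sum_jk (A^T A)_jk p_j p_k = sum_j p_j^2.  The 28 products p_j p_k are
    linearly independent ([gens_products_free]), so A^T A is the identity of
    rank 7, and A has at least seven rows. *)

Set Implicit Arguments.
Unset Strict Implicit.
Unset Printing Implicit Defensive.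

Import Order.TTheory GRing.Theory Num.Theory.
Import numFieldNormedType.Exports.

Local Open Scope ring_scope.

(** * Sums of squares of real polynomials *)

Section SumsOfSquares.
Variable R : realFieldType.

Lemma sum_sqr_eq0 (T : finType) (a : T -> R) :
  \sum_i a i ^+ 2 = 0 -> forall i, a i = 0.
Proof.
move=> h i; apply/eqP; rewrite -sqrf_eq0; apply/eqP.
by apply: (psumr_eq0P _ h) => // j _; exact: sqr_ge0.
Qed.

(** In the product P * P, an index j < k is always paired with an index > k, so
    vanishing on either side of k leaves only the square of the k-th
    coefficient. *)
Lemma coef_sqr_extremal (P : {poly R}) k :
  (forall j, (j < k)%N -> P`_j = 0) \/ (forall j, (k < j)%N -> P`_j = 0) ->
  (P ^+ 2)`_(2 * k) = P`_k ^+ 2.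
Proof.
move=> ext; rewrite expr2 coefM.
have lt_k : (k < (2 * k).+1)%N by lia.
rewrite (bigD1 (Ordinal lt_k)) //= big1 ?addr0.
  by rewrite (_ : 2 * k - k = k)%N ?expr2 //; lia.
move=> j; rewrite -val_eqE /= => neq_jk.
have [lt_jk|lt_kj|eq_jk] := ltngtP j k; last by rewrite eq_jk eqxx in neq_jk.
  case: ext => E; first by rewrite E ?mul0r.
  by rewrite [X in _ * X]E ?mulr0 //; lia.
case: ext => E; last by rewrite E ?mul0r.
by rewrite [X in _ * X]E ?mulr0 //; have := ltn_ord j; lia.
Qed.

(** Squares cannot cancel at an extremal exponent.  Exponents below d are excluded
    in increasing order, those above d in decreasing order from a common degree
    bound. *)
Lemma sum_sqr_monomial (T : finType) (P : T -> {poly R}) d c :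
  \sum_i P i ^+ 2 = c *: 'X^(2 * d) ->
  forall i k, k != d -> (P i)`_k = 0.
Proof.
move=> sumP.
have step k : k != d ->
    (forall i, (forall j, (j < k)%N -> (P i)`_j = 0) \/
               (forall j, (k < j)%N -> (P i)`_j = 0)) ->
    forall i, (P i)`_k = 0.
  move=> neq_kd ext; apply: sum_sqr_eq0.
  under eq_bigr do rewrite -coef_sqr_extremal //.
  rewrite -coef_sum sumP coefZ coefXn.
  by rewrite eqn_mul2l /= (negPf neq_kd) mulr0.
have low k : (k < d)%N -> forall i, (P i)`_k = 0.
  elim/ltn_ind: k => k IH lt_kd; apply: step => [|i]; first by lia.
  by left=> j lt_jk; apply: IH => //; apply: ltn_trans lt_kd.
pose N := \max_i size (P i).
have high n k : (d < k)%N -> (N <= k + n)%N -> forall i, (P i)`_k = 0.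
  elim: n k => [|n IH] k lt_dk le_N i.
    rewrite nth_default // -[k]addn0; apply: leq_trans le_N.
    exact: (leq_bigmax (F := fun j => size (P j))).
  move: i; apply: step => [|i]; first by lia.
  right=> j lt_kj; apply: IH; lia.
move=> i k; case: ltngtP => // [lt_kd|lt_dk] _; first exact: low.
by apply: (high N); rewrite ?leq_addl.
Qed.

(** Restriction to the line spanned by v, with parameter 'X.  Working with this
    ring morphism turns identities between polynomials in n variables into
    identities between univariate polynomials. *)
Lemma mmap_line_homog n d (p : {mpoly R[n]}) (v : 'I_n -> R) :
  p \is d.-homog -> mmap polyC (fun a => v a *: 'X) p = p.@[v] *: 'X^d.
Proof.
move=> /dhomogP homp; rewrite mevalE /mmap scaler_suml; apply: eq_big_seq => m mp.
have <- : mdeg m = d := homp m mp.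
rewrite /mmap1 mul_polyC -scalerA mdegE; congr (_ *: _).
rewrite -prodrXr -scaler_prod; apply: eq_bigr => i _; exact: exprZn.
Qed.

(** The coefficient of 'X^k in the restriction of [q i] to the line spanned by v
    is the value at v of the component of degree k, to which
    [sum_sqr_monomial] applies. *)
Lemma sum_sqr_homog_meval (T : finType) n d (q : T -> {mpoly R[n]}) :
  \sum_i q i ^+ 2 \is (2 * d).-homog ->
  forall i v, (q i).@[v] = (pihomog mdeg d (q i)).@[v].
Proof.
move=> homS i v.
pose P j : {poly R} := mmap polyC (fun a => v a *: 'X) (q j).
have sumP : \sum_j P j ^+ 2 = (\sum_j q j ^+ 2).@[v] *: 'X^(2 * d).
  rewrite -mmap_line_homog // raddf_sum /=.
  by apply: eq_bigr => j _; rewrite rmorphXn.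
have P0 := sum_sqr_monomial sumP i.
pose K := maxn (msize (q i)) d.+1.
have qE : q i = \sum_(k < K) pihomog mdeg k (q i).
  exact: pihomog_partitionE (leq_maxl _ _).
have PE : P i = \poly_(k < K) (pihomog mdeg k (q i)).@[v].
  rewrite poly_def /P [q i in LHS]qE raddf_sum /=.
  by apply: eq_bigr => k _; rewrite (mmap_line_homog _ (pihomogP _ _ _)).
(* K exceeds d so that the component of degree d occurs in the decomposition. *)
have lt_dK : (d < K)%N by exact: leq_maxr.
rewrite [q i in LHS]qE raddf_sum /= (bigD1 (Ordinal lt_dK)) //= big1 ?addr0 //.
move=> k; rewrite -val_eqE /= => /P0; rewrite PE coef_poly ltn_ord; exact.
Qed.
End SumsOfSquares.

Lemma mdeg2_split n (m : 'X_{1..n}) :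
  mdeg m = 2%N -> exists i j, m = (U_(i) + U_(j))%MM.
Proof.
move=> deg2.
have [i mi] : exists i, m i != 0%N.
  apply/existsP; apply: contraTT isT; rewrite negb_exists => /forallP m0.
  suff m_eq0 : m = 0%MM by rewrite m_eq0 mdeg0 in deg2.
  by apply/mnmP => i; rewrite mnm0E; apply/eqP; rewrite -[_ == _]negbK.
have le_im : (U_(i) <= m)%MM by rewrite lep1mP.
have /mdeg1P [j /eqP mj] : mdeg (m - U_(i))%MM == 1%N.
  by rewrite -(eqn_add2r (mdeg U_(i))) -mdegD submK // deg2 mdeg1.
by exists j, i; rewrite -mj submK.
Qed.

Lemma meval_homog2 (R : comNzRingType) n (p : {mpoly R[n]}) : p \is 2.-homog ->
  exists M : 'M[R]_n, forall v, p.@[v] = \sum_i \sum_j M i j * v i * v j.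
Proof.
move=> /dhomogP homp.
suff [M ME] : exists M : 'M[R]_n, forall v : 'I_n -> R,
    \sum_(m <- msupp p) p@_m * \prod_i v i ^+ m i
      = \sum_i \sum_j M i j * v i * v j.
  by exists M => v; rewrite mevalE ME.
elim: (msupp p) homp => [|m s IH] homp.
  exists 0 => v; rewrite big_nil big1 // => i _.
  by rewrite big1 // => j _; rewrite mxE !mul0r.
have [|M ME] := IH; first by move=> m' m's; apply: homp; rewrite inE m's orbT.
have [k [l mE]] := mdeg2_split (homp m (mem_head _ _)).
exists (p@_m *: delta_mx k l + M) => v; rewrite big_cons ME.
transitivity (p@_m * v k * v l + \sum_i \sum_j M i j * v i * v j).
  congr (_ + _); rewrite -mulrA; congr (_ * _).
  rewrite mE; under eq_bigr do rewrite mnmDE exprD !mnm1E.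
  rewrite big_split /=; congr (_ * _).
    rewrite (bigD1 k) //= eqxx big1 ?mulr1 // => i.
    by rewrite eq_sym => /negPf ->.
  rewrite (bigD1 l) //= eqxx big1 ?mulr1 // => i.
  by rewrite eq_sym => /negPf ->.
under [RHS]eq_bigr do under eq_bigr do rewrite !mxE !mulrDl.
under [RHS]eq_bigr do rewrite big_split.
rewrite big_split /=; congr (_ + _).
rewrite (bigD1 k) //= (bigD1 l) //= !eqxx mulr1 !big1 ?addr0 //.
  by move=> i /negPf ->; rewrite big1 // => j _; rewrite mulr0 !mul0r.
by move=> j /negPf ->; rewrite andbF mulr0 !mul0r.
Qed.

(** * The boundary of a set in a finite-dimensional space *)

(** Continuity at 0 of the affine map t |-> u + t w. *)
Lemma row_line_nbhs (R : realType) n (u w : 'rV[R]_n) (B : set 'rV[R]_n) :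
  nbhs u B -> exists2 t, 0 < t & B (u + t *: w).
Proof.
move=> /nbhs_ballP[e /= e0 sub].
pose s := 1 + \sum_j `|w 0 j|.
have s0 : 0 < s by rewrite ltr_pwDl // sumr_ge0.
exists (e / s); first exact: divr_gt0.
apply: sub; split=> // i j; rewrite ord1 !mxE /ball /= opprD addNKr normrN.
rewrite normrM gtr0_norm ?divr_gt0 // mulrAC ltr_pdivrMr // ltr_pM2l //.
by rewrite /s (bigD1 j) //= addrCA ltrDl ltr_pwDl // sumr_ge0.
Qed.

(** Such a direction h is provided by any linear functional that is nonnegative on
    A, zero at v and negative at h. *)
Lemma vect_boundary_ray (R : realType) (V : vectType R) (A : set V) (v h : V) :
  A v -> (forall t, 0 < t -> ~ A (v + t *: h)) -> vect_boundary A v.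
Proof.
move=> Av ray; split; first by apply: subset_closure; exists v.
move=> /(row_line_nbhs (passmx.rVof (vbasis {:V}) h)) [t t0 [a Aa]].
rewrite addrC -passmx.rVof_linear addrC => /(can_inj (passmx.rVofK (vbasisP _))) aE.
by apply: (ray t t0); rewrite -aE.
Qed.

(** * Quadratic forms in five variables and the seven generators *)

Section Example.
Variable R : realType.

Definition pt (x1 x2 x3 x4 x5 : R) : 'I_5 -> R :=
  fun i => [:: x1; x2; x3; x4; x5]`_i.

(** Indices run from 1 to 5, and only the coefficients [c i j] with [i <= j]
    count. *)
Definition qform (c : nat -> nat -> R) (x1 x2 x3 x4 x5 : R) : R :=
  c 1 1 * x1 ^+ 2 + c 2 2 * x2 ^+ 2 + c 3 3 * x3 ^+ 2 + c 4 4 * x4 ^+ 2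
  + c 5 5 * x5 ^+ 2
  + c 1 2 * x1 * x2 + c 1 3 * x1 * x3 + c 1 4 * x1 * x4 + c 1 5 * x1 * x5
  + c 2 3 * x2 * x3 + c 2 4 * x2 * x4 + c 2 5 * x2 * x5
  + c 3 4 * x3 * x4 + c 3 5 * x3 * x5 + c 4 5 * x4 * x5.

Definition is_qform (p : {mpoly R[5]}) (c : nat -> nat -> R) : Prop :=
  forall x1 x2 x3 x4 x5, p.@[pt x1 x2 x3 x4 x5] = qform c x1 x2 x3 x4 x5.

Lemma qform_of_homog p : p \is 2.-homog -> exists c, is_qform p c.
Proof.
move=> /meval_homog2 [M ME].
pose N i j := M (inord i) (inord j).
exists (fun i j => if (i == j)%N then N i.-1 i.-1
                   else N i.-1 j.-1 + N j.-1 i.-1).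
move=> x1 x2 x3 x4 x5; rewrite ME.
under eq_bigr => i _ do under eq_bigr => j _ do
  rewrite -[i in M i]inord_val -[j in M _ j]inord_val -/(N i j).
by rewrite !big_ord_recl !big_ord0 /qform /pt /=; ring.
Qed.

(** The values of p1, ..., p7 at a point, with p4 at position 3. *)
Definition gens (x1 x2 x3 x4 x5 : R) : seq R :=
  [:: x1 ^+ 2 - x4 ^+ 2; x2 ^+ 2 - x4 ^+ 2; x3 ^+ 2 - x4 ^+ 2;
      - x1 ^+ 2 - x1 * x2 - x1 * x3 + x1 * x4 - x2 * x3 + x2 * x4 + x3 * x4;
      x1 * x5 + x2 * x5; x3 * x5 + x2 * x5; x5 ^+ 2].

Lemma meval_g x1 x2 x3 x4 x5 :
  (g R).@[pt x1 x2 x3 x4 x5] = \sum_(j < 7) (gens x1 x2 x3 x4 x5)`_j ^+ 2.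
Proof.
rewrite !big_ord_recl big_ord0 /= /g_poly /p1 /p2 /p3 /p4 /p5 /p6 /p7.
rewrite /Defs.x1 /Defs.x2 /Defs.x3 /Defs.x4 /Defs.x5.
by rewrite !(expr2, mevalM, mevalD, mevalN, mevalXU) /pt /=; ring.
Qed.

Lemma meval_p4 x1 x2 x3 x4 x5 :
  (p4 R).@[pt x1 x2 x3 x4 x5] = (gens x1 x2 x3 x4 x5)`_3.
Proof.
rewrite /p4 /Defs.x1 /Defs.x2 /Defs.x3 /Defs.x4.
by rewrite !(expr2, mevalM, mevalD, mevalN, mevalXU) /pt /=; ring.
Qed.

(** p7 gives x5 = 0, then p1, p2, p3 give x1, x2, x3 = +-x4, and p4 is a nonzero
    multiple of x4^2 for each of the eight choices of signs. *)
Lemma gens_eq0 x1 x2 x3 x4 x5 :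
  (forall j : 'I_7, (gens x1 x2 x3 x4 x5)`_j = 0) ->
  [/\ x1 = 0, x2 = 0, x3 = 0, x4 = 0 & x5 = 0].
Proof.
move=> z.
have := z (inord 0); have := z (inord 1); have := z (inord 2).
have := z (inord 3); have := z (inord 6).
rewrite !inordK //= => /eqP; rewrite sqrf_eq0 => /eqP -> e4.
rewrite !subr_sqr => /eqP e3 /eqP e2 /eqP e1; move: e1 e2 e3 e4.
rewrite !mulf_eq0 !subr_eq0 !addr_eq0.
move=> /orP[] /eqP -> /orP[] /eqP -> /orP[] /eqP -> e4.
all: have : x4 ^+ 2 = 0 by lra.
all: by move=> /eqP; rewrite sqrf_eq0 => /eqP ->; rewrite ?oppr0.
Qed.

Lemma g_pos : strictly_positive (g R).
Proof.
move=> x; apply: contraNT; rewrite -leNgt.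
have xE : x 0 =1 pt (x 0 (inord 0)) (x 0 (inord 1)) (x 0 (inord 2))
                    (x 0 (inord 3)) (x 0 (inord 4)).
  by case=> [[|[|[|[|[|]]]]] lt] //=; congr (x 0 _);
    apply: val_inj; rewrite /= inordK.
rewrite (meval_eq _ xE) meval_g => le0.
have /sum_sqr_eq0 /gens_eq0 [z0 z1 z2 z3 z4] :
    \sum_(j < 7) (gens (x 0 (inord 0)) (x 0 (inord 1)) (x 0 (inord 2))
                       (x 0 (inord 3)) (x 0 (inord 4)))`_j ^+ 2 = 0.
  by apply/eqP; rewrite eq_le le0 sumr_ge0 // => j _; exact: sqr_ge0.
apply/eqP/rowP => i; rewrite mxE xE z0 z1 z2 z3 z4 /pt.
by case: i => [[|[|[|[|[|]]]]] lt].
Qed.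

(** * The two functionals *)

Definition cube_vertices : seq ('I_5 -> R) :=
  [:: pt 1 1 1 1 0; pt (-1) 1 1 1 0; pt 1 (-1) 1 1 0; pt 1 1 (-1) 1 0;
      pt 1 (-1) (-1) 1 0; pt (-1) 1 (-1) 1 0; pt (-1) (-1) 1 1 0].

Definition last_vertex : 'I_5 -> R := pt (-1) (-1) (-1) 1 0.

(** The weight -1/7 makes the functional vanish at p4^2, whose value is 1 at the
    seven vertices and 49 at the last one. *)
Definition cube (f : {mpoly R[5]}) : R :=
  \sum_(v <- cube_vertices) f.@[v] - 7^-1 * f.@[last_vertex].

(** For f of degree at most 4 in x5 this is the coefficient of x5^2 in f: the
    five-point formula for half a second derivative is exact on quartics.  It
    keeps all functionals linear combinations of evaluations. *)
Definition x5sqr_coef (f : {mpoly R[5]}) (x1 x2 x3 x4 : R) : R :=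
  (16 * (f.@[pt x1 x2 x3 x4 1] + f.@[pt x1 x2 x3 x4 (- 1)])
   - (f.@[pt x1 x2 x3 x4 2] + f.@[pt x1 x2 x3 x4 (- 2)])
   - 30 * f.@[pt x1 x2 x3 x4 0]) / 24.

Definition slope (f : {mpoly R[5]}) : R :=
  x5sqr_coef f (-1) 1 (-1) 0 + x5sqr_coef f 0 0 0 1.

Lemma cube_sum (T : Type) (s : seq T) (F : T -> {mpoly R[5]}) :
  cube (\sum_(i <- s) F i) = \sum_(i <- s) cube (F i).
Proof.
elim: s => [|a s IH]; last rewrite !big_cons -IH /cube.
  by rewrite !big_nil /cube !big_cons !big_nil !meval0; ring.
by rewrite !big_cons !big_nil !mevalD; ring.
Qed.

Lemma slope_sum (T : Type) (s : seq T) (F : T -> {mpoly R[5]}) :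
  slope (\sum_(i <- s) F i) = \sum_(i <- s) slope (F i).
Proof.
elim: s => [|a s IH]; last rewrite !big_cons -IH /slope /x5sqr_coef.
  by rewrite !big_nil /slope /x5sqr_coef !meval0; ring.
by rewrite !mevalD; ring.
Qed.

Lemma cube_g : cube (g R) = 0.
Proof.
rewrite /cube !big_cons big_nil !meval_g !big_ord_recl !big_ord0 /=.
by field.
Qed.

Lemma slope_g : slope (g R) = 0.
Proof.
rewrite /slope /x5sqr_coef !meval_g !big_ord_recl !big_ord0 /=.
by field.
Qed.

(** With y_v = p4(v) q(v), where p4(v) = +-1, the Cayley-Bacharach relation says
    that the sum of the y_v over the seven vertices is - q(last_vertex).  So
    [cube (q ^+ 2)] is the sum of the y_v^2 minus (sum of the y_v)^2 / 7, that is,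
    the sum of the squared deviations of the y_v from their mean. *)
Lemma cube_sqr q c : is_qform q c ->
  cube (q ^+ 2) = \sum_(v <- cube_vertices)
    (q.@[v] + 7^-1 * q.@[last_vertex] * (p4 R).@[v]) ^+ 2.
Proof.
move=> qE; rewrite /cube !big_cons !big_nil !rmorphXn /= !meval_p4 !qE.
rewrite /qform /=.
by field.
Qed.

Lemma cube_sqr_ge0 q c : is_qform q c -> 0 <= cube (q ^+ 2).
Proof. by move=> qE; rewrite (cube_sqr qE) sumr_ge0 // => v _; exact: sqr_ge0. Qed.

(** These equations say that the restriction of q to x5 = 0 is a combination of
    p1, ..., p4, in which p4 has coefficient [c 1 4]. *)
Lemma cube_sqr_eq0 q c : is_qform q c -> cube (q ^+ 2) = 0 ->
  [/\ c 1 2 = - c 1 4, c 1 3 = - c 1 4, c 2 3 = - c 1 4,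
      c 2 4 = c 1 4 & c 3 4 = c 1 4 /\
      c 1 1 + c 2 2 + c 3 3 + c 4 4 = - c 1 4].
Proof.
move=> qE; rewrite (cube_sqr qE) => /eqP.
rewrite psumr_eq0 => [|v _]; last exact: sqr_ge0.
rewrite /= !sqrf_eq0 andbT !meval_p4 !qE /qform /=.
move=> /and5P[/eqP h1 /eqP h2 /eqP h3 /eqP h4 /and3P[/eqP h5 /eqP h6 /eqP h7]].
by do !split; lra.
Qed.

(** At a point w with x5 = 0, write q(w + s e5) = q(w) + s L(w) + s^2 [c 5 5]: the
    coefficient of s^2 in the square is L(w)^2 + 2 [c 5 5] q(w).  The points are
    chosen so that p1, ..., p4, hence all forms allowed by [cube_sqr_eq0], have
    opposite values at them; the terms without sign then cancel. *)
Lemma slope_sqr q c : is_qform q c -> cube (q ^+ 2) = 0 ->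
  slope (q ^+ 2) = (c 2 5 - c 1 5 - c 3 5) ^+ 2 + c 4 5 ^+ 2.
Proof.
move=> qE /(cube_sqr_eq0 qE) [e12 e13 e23 e24 [e34 etr]].
have -> : slope (q ^+ 2) = (c 2 5 - c 1 5 - c 3 5) ^+ 2 + c 4 5 ^+ 2
    + 2 * c 5 5 * (c 1 1 + c 2 2 + c 3 3 + c 4 4 - c 1 2 + c 1 3 - c 2 3).
  rewrite /slope /x5sqr_coef !rmorphXn /= !qE /qform.
  by field.
by rewrite e12 e13 e23 etr; ring.
Qed.

Lemma slope_sqr_eq0 q c : is_qform q c ->
  cube (q ^+ 2) = 0 -> slope (q ^+ 2) = 0 ->
  exists a : nat -> R, forall x1 x2 x3 x4 x5,
    q.@[pt x1 x2 x3 x4 x5] = \sum_(j < 7) a j * (gens x1 x2 x3 x4 x5)`_j.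
Proof.
move=> qE q0; rewrite (slope_sqr qE q0) => /eqP.
rewrite paddr_eq0 ?sqr_ge0 // !sqrf_eq0 => /andP[/eqP e25 /eqP e45].
have [e12 e13 e23 e24 [e34 etr]] := cube_sqr_eq0 qE q0.
have {}e25 : c 2 5 = c 1 5 + c 3 5 by lra.
have e44 : c 4 4 = - c 1 4 - c 1 1 - c 2 2 - c 3 3 by lra.
exists (nth 0 [:: c 1 1 + c 1 4; c 2 2; c 3 3; c 1 4; c 1 5; c 3 5; c 5 5]).
move=> x1 x2 x3 x4 x5; rewrite qE /qform e12 e13 e23 e24 e34 e25 e44 e45.
by rewrite !big_ord_recl big_ord0 /=; ring.
Qed.

(** * The boundary of the cone *)

Lemma cube_Sigma54_ge0 (f : dhomog 5 R 4) : Sigma54 R f -> 0 <= cube f.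
Proof.
move=> [s ->]; rewrite cube_sum sumr_ge0 // => q _.
have [c qE] := qform_of_homog (valP q).
exact: cube_sqr_ge0 qE.
Qed.

Lemma p_homog (p : {mpoly R[5]}) :
  p \in [:: p1 R; p2 R; p3 R; p4 R; p5 R; p6 R; p7 R] -> p \is 2.-homog.
Proof.
have hX (i j : 'I_5) : ('X_i * 'X_j : {mpoly R[5]}) \is 2.-homog.
  by apply: (@dhomogM _ _ _ 1 _ 1); rewrite dhomogX; apply/eqP; exact: mdeg1.
rewrite !inE; do ![case/orP]; move=> /eqP ->;
  rewrite /p1 /p2 /p3 /p4 /p5 /p6 /p7 ?expr2;
  do ![apply: rpredD | apply: rpredB | rewrite rpredN | exact: hX].
Qed.

Lemma g_Sigma54 : Sigma54 R (g R).
Proof.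
have hp i : (i < 7)%N ->
    [:: p1 R; p2 R; p3 R; p4 R; p5 R; p6 R; p7 R]`_i \is 2.-homog.
  by move=> lt_i; apply: p_homog; exact: mem_nth.
exists [seq DHomog (hp i (ltn_ord i)) | i : 'I_7 <- enum 'I_7].
rewrite big_map big_enum /= !big_ord_recl big_ord0 /=.
by rewrite /g_poly addr0 !addrA.
Qed.

Lemma x1_homog4 : (Defs.x1 R ^+ 4) \is 4.-homog.
Proof. by apply: (@dhomogMn _ _ _ 1 _ 4); rewrite dhomogX; apply/eqP/mdeg1. Qed.

Lemma g_boundary : vect_boundary (Sigma54 R) (g R).
Proof.
apply: (@vect_boundary_ray _ _ _ _ (- DHomog x1_homog4)) g_Sigma54 _ => t t0.
move=> /cube_Sigma54_ge0; apply/negP; rewrite -ltNge.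
have -> : cube (mpoly_of_dhomog (g R + t *: - DHomog x1_homog4))
    = cube (g R) - t * cube (Defs.x1 R ^+ 4).
  have -> : mpoly_of_dhomog (g R + t *: - DHomog x1_homog4)
      = g_poly R + t *: - Defs.x1 R ^+ 4 by [].
  by rewrite /cube !big_cons !big_nil !mevalD !mevalZ !mevalN; ring.
rewrite cube_g sub0r oppr_lt0 mulr_gt0 //.
rewrite /cube !big_cons big_nil !rmorphXn /= /Defs.x1 !mevalXU.
by rewrite /last_vertex /pt /=; lra.
Qed.

(** * Decompositions into squares *)

(** Linear independence of the products p_j p_k.  Each identity below is the
    relation at one point; the 28 points are taken where most generators vanish,
    in an order that makes the linear system block triangular with small blocks. *)
Lemma gens_products_free (s : nat -> nat -> R) :
  (forall j k, s j k = s k j) ->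
  (forall x1 x2 x3 x4 x5, \sum_(j < 7) \sum_(k < 7)
     s j k * (gens x1 x2 x3 x4 x5)`_j * (gens x1 x2 x3 x4 x5)`_k = 0) ->
  forall j k, (j < 7)%N -> (k < 7)%N -> s j k = 0.
Proof.
move=> sC s0.
have E x1 x2 x3 x4 x5 :
  let p := gens x1 x2 x3 x4 x5 in
  s 0 0 * p`_0 ^+ 2 + s 1 1 * p`_1 ^+ 2 + s 2 2 * p`_2 ^+ 2 + s 3 3 * p`_3 ^+ 2
  + s 4 4 * p`_4 ^+ 2 + s 5 5 * p`_5 ^+ 2 + s 6 6 * p`_6 ^+ 2
  + 2 * (s 0 1 * p`_0 * p`_1 + s 0 2 * p`_0 * p`_2 + s 0 3 * p`_0 * p`_3
  + s 0 4 * p`_0 * p`_4 + s 0 5 * p`_0 * p`_5 + s 0 6 * p`_0 * p`_6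
  + s 1 2 * p`_1 * p`_2 + s 1 3 * p`_1 * p`_3 + s 1 4 * p`_1 * p`_4
  + s 1 5 * p`_1 * p`_5 + s 1 6 * p`_1 * p`_6
  + s 2 3 * p`_2 * p`_3 + s 2 4 * p`_2 * p`_4 + s 2 5 * p`_2 * p`_5
  + s 2 6 * p`_2 * p`_6 + s 3 4 * p`_3 * p`_4 + s 3 5 * p`_3 * p`_5
  + s 3 6 * p`_3 * p`_6 + s 4 5 * p`_4 * p`_5 + s 4 6 * p`_4 * p`_6
  + s 5 6 * p`_5 * p`_6) = 0.
  move=> p; rewrite -[RHS](s0 x1 x2 x3 x4 x5) !big_ord_recl !big_ord0 /= -/p.
  rewrite /bump /=.
  rewrite (sC 1 0)%N (sC 2 0)%N (sC 3 0)%N (sC 4 0)%N (sC 5 0)%N (sC 6 0)%N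
    (sC 2 1)%N (sC 3 1)%N (sC 4 1)%N (sC 5 1)%N (sC 6 1)%N (sC 3 2)%N (sC 4 2)%N
    (sC 5 2)%N (sC 6 2)%N (sC 4 3)%N (sC 5 3)%N (sC 6 3)%N (sC 5 4)%N (sC 6 4)%N
    (sC 6 5)%N.
  by ring.
have s11 : s 1 1 = 0 by have := E 0 (-1) 0 0 0; rewrite /=; lra.
have s22 : s 2 2 = 0 by have := E 0 0 (-1) 0 0; rewrite /=; lra.
have s66 : s 6 6 = 0 by have := E 0 0 0 0 (-1); rewrite /=; lra.
have s33 : s 3 3 = 0 by have := E (-1) (-1) (-1) (-1) 0; rewrite /=; lra.
have h0 : s 0 0 - 2 * s 0 3 = 0.
  by have := E (-1) 0 0 0 0; rewrite /=; lra.
have h1 : s 0 0 + 6 * s 0 3 = 0.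
  by have := E 0 (-1) (-1) 1 0; rewrite /=; lra.
have s00 : s 0 0 = 0 by lra.
have s03 : s 0 3 = 0 by lra.
clear h0 h1.
have s12 : s 1 2 = 0 by have := E (-1) 0 0 (-1) 0; rewrite /=; lra.
have s02 : s 0 2 = 0 by have := E (-1) 0 1 0 0; rewrite /=; lra.
have s01 : s 0 1 = 0 by have := E (-1) 1 0 0 0; rewrite /=; lra.
have s23 : s 2 3 = 0 by have := E (-1) (-1) 0 1 0; rewrite /=; lra.
have s13 : s 1 3 = 0 by have := E (-1) 0 (-1) 1 0; rewrite /=; lra.
have s36 : s 3 6 = 0 by have := E (-1) 1 (-1) (-1) (-1); rewrite /=; lra.
have h0 : 2 * s 2 5 + 2 * s 2 6 + s 5 5 + 2 * s 5 6 = 0.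
  by have := E 0 0 (-1) 0 (-1); rewrite /=; lra.
have h1 : - 2 * s 2 5 + 2 * s 2 6 + s 5 5 - 2 * s 5 6 = 0.
  by have := E 0 0 (-1) 0 1; rewrite /=; lra.
have h2 : - 4 * s 2 5 + 8 * s 2 6 + 4 * s 5 5 - 16 * s 5 6 = 0.
  by have := E 0 0 (-1) 0 2; rewrite /=; lra.
have h3 : 2 * s 2 5 - 2 * s 2 6 + s 5 5 - 2 * s 5 6 = 0.
  by have := E (-1) 1 0 (-1) (-1); rewrite /=; lra.
have s55 : s 5 5 = 0 by lra.
have s25 : s 2 5 = 0 by lra.
have s26 : s 2 6 = 0 by lra.
have s56 : s 5 6 = 0 by lra.
clear h0 h1 h2 h3.
have h0 : 4 * s 3 4 + 4 * s 4 4 + 4 * s 4 6 = 0.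
  by have := E (-1) (-1) 1 (-1) (-1); rewrite /=; lra.
have h1 : - 4 * s 3 4 + 4 * s 4 4 - 4 * s 4 6 = 0.
  by have := E (-1) (-1) 1 (-1) 1; rewrite /=; lra.
have h2 : - 4 * s 3 4 + 4 * s 4 4 + 4 * s 4 6 = 0.
  by have := E (-1) (-1) 1 1 (-1); rewrite /=; lra.
have s44 : s 4 4 = 0 by lra.
have s34 : s 3 4 = 0 by lra.
have s46 : s 4 6 = 0 by lra.
clear h0 h1 h2.
have s35 : s 3 5 = 0 by have := E (-1) 1 1 (-1) (-1); rewrite /=; lra.
have h0 : 2 * s 0 4 + 2 * s 0 6 = 0.
  by have := E (-1) 0 0 0 (-1); rewrite /=; lra.
have h1 : - 2 * s 0 4 + 2 * s 0 6 = 0.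
  by have := E (-1) 0 0 0 1; rewrite /=; lra.
have s04 : s 0 4 = 0 by lra.
have s06 : s 0 6 = 0 by lra.
clear h0 h1.
have s16 : s 1 6 = 0 by have := E 0 0 0 (-1) (-1); rewrite /=; lra.
have h0 : 2 * s 1 4 + 2 * s 1 5 + 2 * s 4 5 = 0.
  by have := E 0 (-1) 0 0 (-1); rewrite /=; lra.
have h1 : - 2 * s 1 4 - 2 * s 1 5 + 2 * s 4 5 = 0.
  by have := E 0 (-1) 0 0 1; rewrite /=; lra.
have h2 : - 2 * s 1 4 - 2 * s 2 4 = 0.
  by have := E (-1) 0 0 (-1) (-1); rewrite /=; lra.
have h3 : - 2 * s 0 5 - 2 * s 1 5 = 0.
  by have := E (-1) 1 0 0 (-1); rewrite /=; lra.
have h4 : - 2 * s 1 4 + 2 * s 1 5 - 2 * s 4 5 = 0.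
  by have := E (-1) 0 1 (-1) (-1); rewrite /=; lra.
have s14 : s 1 4 = 0 by lra.
have s15 : s 1 5 = 0 by lra.
have s45 : s 4 5 = 0 by lra.
have s05 : s 0 5 = 0 by lra.
have s24 : s 2 4 = 0 by lra.
clear h0 h1 h2 h3 h4.
move=> j k; wlog le_jk : j k / (j <= k)%N => [IH lt_j lt_k|].
  by case/orP: (leq_total j k) => /IH; [|rewrite sC]; apply.
case: j le_jk => [|[|[|[|[|[|[|j]]]]]]];
  by case: k => [|[|[|[|[|[|[|k]]]]]]].
Qed.

(** The rows of A are the coordinates of the q_i with respect to p1, ..., p7; they
    exist because both functionals vanish at g and are nonnegative, one after the
    other, on every q_i^2. *)
Lemma g_gram (m : nat) (q : 'I_m -> {mpoly R[5]}) :
  mpoly_of_dhomog (g R) = \sum_i q i ^+ 2 ->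
  exists A : 'M[R]_(m, 7), A^T *m A = 1%:M.
Proof.
move=> gE.
have homg : \sum_i q i ^+ 2 \is (2 * 2).-homog by rewrite -gE; exact: g_poly_homog.
have /choice [c qE] i : exists c, is_qform (q i) c.
  have [c cE] := qform_of_homog (pihomogP mdeg 2 (q i)).
  by exists c => y1 y2 y3 y4 y5; rewrite (sum_sqr_homog_meval homg) cE.
have cube0 i : cube (q i ^+ 2) = 0.
  have := cube_g; rewrite gE cube_sum => /psumr_eq0P; apply => // j _.
  exact: cube_sqr_ge0 (qE j).
have slope0 i : slope (q i ^+ 2) = 0.
  have := slope_g; rewrite gE slope_sum => /psumr_eq0P; apply => // j _.
  by rewrite (slope_sqr (qE j) (cube0 j)) addr_ge0 ?sqr_ge0.
have [a aE] := choice (fun i => slope_sqr_eq0 (qE i) (cube0 i) (slope0 i)).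
exists (\matrix_(i, j) a i j); apply/matrixP => j k; rewrite !mxE.
under eq_bigr do rewrite !mxE.
apply/eqP; rewrite -subr_eq0; apply/eqP.
pose s j k := \sum_i a i j * a i k - (j == k)%:R.
apply: (gens_products_free (s := s)) => // {j k}.
  by move=> j k; rewrite /s eq_sym; under eq_bigr do rewrite mulrC.
move=> x1 x2 x3 x4 x5; set p := gens _ _ _ _ _.
have sqE : \sum_i (\sum_(j < 7) a i j * p`_j) ^+ 2 = \sum_(j < 7) p`_j ^+ 2.
  rewrite -meval_g gE raddf_sum /=; apply: eq_bigr => i _.
  by rewrite rmorphXn /= aE.
have diagE : \sum_(j < 7) \sum_(k < 7) (j == k)%:R * p`_j * p`_k
    = \sum_(j < 7) p`_j ^+ 2.
  apply: eq_bigr => j _; rewrite (bigD1 j) //= eqxx mul1r big1 ?addr0 // => k.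
  by rewrite eq_sym => /negPf ->; rewrite !mul0r.
have gramE : \sum_(j < 7) \sum_(k < 7) (\sum_i a i j * a i k) * p`_j * p`_k
    = \sum_(j < 7) p`_j ^+ 2.
  rewrite -sqE; under [RHS]eq_bigr do rewrite expr2 big_distrlr /=.
  rewrite [RHS]exchange_big; apply: eq_bigr => j _.
  rewrite [RHS]exchange_big; apply: eq_bigr => k _.
  by rewrite !mulr_suml; apply: eq_bigr => i _; ring.
transitivity (\sum_(j < 7) \sum_(k < 7) (\sum_i a i j * a i k) * p`_j * p`_k
              - \sum_(j < 7) \sum_(k < 7) (j == k)%:R * p`_j * p`_k).
  rewrite -sumrB; apply: eq_bigr => j _; rewrite -sumrB.
  by apply: eq_bigr => k _; rewrite /s !mulrBl.
by rewrite gramE diagE subrr.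
Qed.

End Example.

Theorem proposition5p8 (R : realType) :
  [/\ strictly_positive (g R),
      vect_boundary (Sigma54 R) (g R)
    & ~ exists q : 'I_6 -> {mpoly R[5]},
        mpoly_of_dhomog (g R) = \sum_(i < 6) q i ^+ 2].
Proof.
split; [exact: g_pos | exact: g_boundary |].
move=> [q /g_gram [A AA]].
have := mxrankM_maxr A^T A; rewrite AA mxrank1.
by move=> /leq_trans /(_ (rank_leq_row A)).
Qed.
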